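(* Let $G$ be an elementary totally disconnected, locally compact second-countable group and let $\alpha$ be an ordinal such that $\alpha+2 \le \xi(G)$. Then there is a compactly generated open subgroup $O$ of $G$ such that $\xi(O) = \alpha+2$.
   Context: All topological groups are Hausdorff. Write t.d.l.c.s.c. for totally disconnected, locally compact, second-countable. A group is compactly generated if it is generated by a compact subset. For a topological group $O$, $\mathrm{Res}(O)$ is the intersection of all open normal subgroups of $O$. The class $\mathscr{E}$ of elementary groups is the smallest class of t.d.l.c.s.c. groups such that: (i) $\mathscr{E}$ contains all second-countable profinite groups and all countable discrete groups; (ii) $\mathscr{E}$ is closed under taking closed subgroups; (iii) $\mathscr{E}$ is closed under taking Hausdorff quotients; (iv) $\mathscr{E}$ is closed under forming extensions that result in a t.d.l.c.s.c. group; (v) if $G$ is a t.d.l.c.s.c. group and $G=\bigcup_{i\in\mathbb{N}}O_i$ where $(O_i)_{i\in\mathbb{N}}$ is an increasing sequence of open subgroups of $G$ with $O_i\in\mathscr{E}$ for each $i$, then $G\in\mathscr{E}$. The decomposition rank $\xi$ is the partial ordinal-valued function from the class of t.d.l.c.s.c. groups to $[1,\omega_1)$ ($\omega_1$ the first uncountable ordinal) satisfying: (a) $\xi(G)=1$ if and only if $G=\{1\}$; (b) if $G$ is a nontrivial t.d.l.c.s.c. group and $G=\bigcup_{i\in\mathbb{N}}O_i$ with $(O_i)_{i\in\mathbb{N}}$ some increasing sequence of compactly generated open subgroups of $G$, then $\xi(G)$ is defined if and only if $\xi(R_i)$ is defined for $R_i:=\mathrm{Res}(O_i)$ for all $i\in\mathbb{N}$,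 and in that case $\xi(G)=\bigl(\sup_{i\in\mathbb{N}}\xi(R_i)\bigr)+1$. It is known (Wesolek) that such a function exists, is unique, and has domain of definition exactly $\mathscr{E}$. *)

(* Defs.v *)
From HB Require Import structures.
From mathcomp Require Import all_boot all_order all_classical topology.

Set Implicit Arguments.
Unset Strict Implicit.
Unset Printing Implicit Defensive.

Import Order.TTheory.

Local Open Scope classical_set_scope.

(* [Otree f] denotes the least ordinal above all the ordinals [f i]; the type
   [ordinal_number] identifies the trees that denote the same ordinal. *)
Inductive otree : Type := Otree (A : Type) (f : A -> otree).

Fixpoint otree_le (s t : otree) : Prop :=
  let: Otree A f := s in let: Otree B g := t in
  forall i, exists j, otree_le (f i) (g j).

Lemma otree_le_refl s : otree_le s s.
Proof. by elim: s => A f IH /= i; exists i. Qed.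

Lemma otree_le_trans t s u : otree_le s t -> otree_le t u -> otree_le s u.
Proof.
elim: s t u => I f IH [J g] [K h] /= fg gh i.
have [j fgij] := fg i; have [k ghjk] := gh j.
by exists k; apply: IH fgij ghjk.
Qed.

Lemma otree_le_total s t : otree_le s t \/ otree_le t s.
Proof.
elim: s t => I f IH [J g] /=.
have [?|/existsNP[i /forallNP nfg]] :=
  pselect (forall i, exists j, otree_le (f i) (g j)); first by left.
by right=> j; exists i; case: (IH i (g j)) => // /nfg.
Qed.

Lemma otree_le_irr (A : Type) (f : A -> otree) i : ~ otree_le (Otree f) (f i).
Proof.
move: (erefl (f i)); move: {2 3}(f i) => t; elim: t A f i => B g IH A f i fiE.
by move=> /(_ i) [j]; rewrite fiE; exact: (IH j B g j).
Qed.

Lemma otree_leN (A : Type) (f : A -> otree) s :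
  ~ otree_le (Otree f) s <-> exists i, otree_le s (f i).
Proof.
split=> [|[i sfi] fs]; last exact: otree_le_irr (otree_le_trans fs sfi).
elim: s A f => K h IH A f /existsNP[i /forallNP ni]; exists i.
by case: (f i) ni => J g ni k; exact: IH (ni k).
Qed.

HB.instance Definition _ := gen_eqMixin otree.
HB.instance Definition _ := gen_choiceMixin otree.

Definition otree_eq (s t : otree) : bool :=
  `[< otree_le s t /\ otree_le t s >].

Lemma otree_eq_equiv : equiv_class_of otree_eq.
Proof.
split=> [s|s t|t s u].
- by apply/asboolP; split; exact: otree_le_refl.
- by apply/asboolP/asboolP=> -[].
- move=> /asboolP[st ts] /asboolP[tu ut]; apply/asboolP.
  by split; apply: (@otree_le_trans t).
Qed.

Canonical otree_equiv_rel := EquivRelPack otree_eq_equiv.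

Definition ordinal_number := {eq_quot otree_eq}%qT.

HB.instance Definition _ := Choice.on ordinal_number.

Section OrdinalOrder.
Local Open Scope quotient_scope.

Definition ordinal_le (a b : ordinal_number) : bool :=
  `[< otree_le (repr a) (repr b) >].

Lemma ordinal_le_refl : reflexive ordinal_le.
Proof. by move=> a; apply/asboolP; exact: otree_le_refl. Qed.

Lemma ordinal_le_anti : antisymmetric ordinal_le.
Proof.
move=> a b /andP[/asboolP ab /asboolP ba].
by rewrite -[a]reprK -[b]reprK; apply/eqmodP/asboolP.
Qed.

Lemma ordinal_le_trans : transitive ordinal_le.
Proof.
move=> b a c /asboolP ab /asboolP bc; apply/asboolP.
exact: otree_le_trans ab bc.
Qed.

Lemma ordinal_le_total : total ordinal_le.
Proof.
move=> a b; case: (otree_le_total (repr a) (repr b)) => ?.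
- by apply/orP; left; apply/asboolP.
- by apply/orP; right; apply/asboolP.
Qed.

End OrdinalOrder.

Fact ordinal_display : Order.disp_t. Proof. exact: Order.Disp tt tt. Qed.

HB.instance Definition _ :=
  Order.Le_isPOrder.Build ordinal_display ordinal_number
  ordinal_le_refl ordinal_le_anti ordinal_le_trans.
HB.instance Definition _ :=
  Order.POrder_isTotal.Build ordinal_display ordinal_number ordinal_le_total.

Definition ozero : ordinal_number :=
  (\pi_ordinal_number (Otree (of_void otree)))%qT.

(* The least ordinal above all the [f i]. *)
Definition oabove (A : Type) (f : A -> ordinal_number) : ordinal_number :=
  (\pi_ordinal_number (Otree (fun i => repr (f i))))%qT.

Definition osucc (a : ordinal_number) : ordinal_number :=
  oabove (fun _ : unit => a).

Section OrdinalTheory.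
Local Open Scope order_scope.
Local Open Scope quotient_scope.

Lemma ordinal_le_piE s t :
  (\pi_ordinal_number s <= \pi_ordinal_number t :> ordinal_number) =
  `[< otree_le s t >].
Proof.
have rK u : otree_le (repr (\pi_ordinal_number u)) u /\
            otree_le u (repr (\pi_ordinal_number u)).
  by have /eqmodP/asboolP := reprK (\pi_ordinal_number u).
have [s1 s2] := rK s; have [t1 t2] := rK t.
apply/asboolP/asboolP => [st|st].
- exact: otree_le_trans s2 (otree_le_trans st t1).
- exact: otree_le_trans s1 (otree_le_trans st t2).
Qed.

Lemma ozero_le a : ozero <= a.
Proof.
by rewrite -[a]reprK ordinal_le_piE; apply/asboolP; case: (repr a) => ? ? [].
Qed.

Lemma oabove_le (A : Type) (f : A -> ordinal_number) (a : ordinal_number) :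
  oabove f <= a <-> forall i, f i < a.
Proof.
have ltE i : f i < a <-> ~ otree_le (repr a) (repr (f i)).
  rewrite ltNge; split=> [/negP na af|na]; first by apply/na/asboolP.
  by apply/negP=> /asboolP.
rewrite -[X in oabove f <= X]reprK ordinal_le_piE; split=> [/asboolP fa i|fa].
- apply/ltE; case: (repr a) fa => J g fg; exact/otree_leN.
- apply/asboolP; move: ltE; case: (repr a) => J g ltE i.
  by apply/otree_leN/ltE.
Qed.

Lemma osucc_le a b : (osucc a <= b) = (a < b).
Proof.
by apply/idP/idP => [/oabove_le/(_ tt)//|ab]; apply/oabove_le => -[].
Qed.

Lemma ordinal_ind (P : ordinal_number -> Prop) :
  (forall a, (forall b, b < a -> P b) -> P a) -> forall a, P a.
Proof.
move=> Pi a; suff: forall t b, otree_le (repr b) t -> P b.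
  by move/(_ (repr a) a); apply; exact: otree_le_refl.
elim=> A f IH b bf; apply: Pi => c; rewrite ltNge => /negP cb.
have {}cb : ~ otree_le (repr b) (repr c) by move=> bc; exact/cb/asboolP.
case: (repr b) bf cb => J g gf /otree_leN[j cgj].
by have [i gfi] := gf j; exact: IH (otree_le_trans cgj gfi).
Qed.

Lemma ex_isLub (A : Type) (f : A -> ordinal_number) :
  exists s, isLub (range f) s.
Proof.
suff min b : ubound (range f) b -> exists s, isLub (range f) s.
  apply: (min (oabove f)) => _ [i _ <-]; apply/ltW.
  by have /oabove_le := lexx (oabove f); apply.
elim/ordinal_ind: b => b IH ub.
have [[c [/IH cIH uc]]|nc] := pselect (exists c, c < b /\ ubound (range f) c).
  exact: cIH.
exists b; split=> // c uc; rewrite leNgt; apply/negP => cb.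
by apply: nc; exists c.
Qed.

End OrdinalTheory.

HB.mixin Record isTopologicalGroup G & Topological G & Group G := {
  mulg_continuous : continuous (fun xy : G * G => xy.1 * xy.2)%g;
  invg_continuous : continuous (fun x : G => x^-1)%g
}.

#[short(type="topologicalGroupType")]
HB.structure Definition TopologicalGroup :=
  {G of Topological G & Group G & isTopologicalGroup G}.

Record subgroup (G : groupType) := Subgroup {
  subgroup_set :> set G;
  subgroup_closed : group_closed [in subgroup_set] }.

(* A subgroup [H], seen as a type through [set_type], is a topological group
   for the induced topology. *)
Section SubgroupType.
Variables (G : topologicalGroupType) (H : subgroup G).

HB.instance Definition _ := SubType.on (set_type H).
HB.instance Definition _ :=
  SubChoice_isSubGroup.Build G _ (set_type H) (subgroup_closed H).

Let val_continuous : continuous (val : set_type H -> G).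
Proof. exact: initial_continuous. Qed.

Let continuous_in (T : topologicalType) (f : T -> set_type H) :
  continuous (val \o f) -> continuous f.
Proof.
move=> /continuousP cf; apply/continuousP => _ [U oU <-].
by rewrite -comp_preimage; exact: cf.
Qed.

Let mulH_continuous :
  continuous (fun xy : set_type H * set_type H => xy.1 * xy.2)%g.
Proof.
apply: continuous_in => -[x y] /=.
rewrite (_ : val \o _ =
             fun xy : set_type H * set_type H => val xy.1 * val xy.2)%g;
  last by apply/funext => z; exact: gmulfM.
apply: (@continuous_comp _ _ _
  (fun xy : set_type H * set_type H => (val xy.1, val xy.2))
  (fun ab : G * G => ab.1 * ab.2)%g); last exact: mulg_continuous.
apply: cvg_pair.
- by apply: continuous_comp; [exact: cvg_fst|exact: val_continuous].
- by apply: continuous_comp; [exact: cvg_snd|exact: val_continuous].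
Qed.

Let invH_continuous : continuous (fun x : set_type H => x^-1)%g.
Proof.
apply: continuous_in => x.
rewrite (_ : val \o _ = fun x : set_type H => (val x)^-1)%g;
  last by apply/funext => z; exact: gmulfV.
by apply: continuous_comp; [exact: val_continuous|exact: invg_continuous].
Qed.

HB.instance Definition _ :=
  isTopologicalGroup.Build (set_type H) mulH_continuous invH_continuous.

End SubgroupType.

Section SubgroupIntersection.
Variables (G : groupType) (F : set (subgroup G)).

Lemma bigcap_subgroup_closed : group_closed [in \bigcap_(H in F) (H : set G)].
Proof.
split=> [|x y /set_mem Fx /set_mem Fy]; apply/mem_set => H FH; apply/set_mem.
- by have [] := subgroup_closed H.
- have [_] := subgroup_closed H; apply; apply/mem_set; [exact: Fx|exact: Fy].
Qed.

Definition subgroup_bigcap : subgroup G := Subgroup bigcap_subgroup_closed.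

End SubgroupIntersection.

Definition generated_subgroup (G : groupType) (K : set G) : subgroup G :=
  subgroup_bigcap [set H : subgroup G | K `<=` H].

Definition normal_subgroup (G : groupType) (N : subgroup G) : Prop :=
  forall x y : G, (N : set G) x -> (N : set G) (x ^ y)%g.

Definition trivial_group (G : groupType) : Prop := [set: G] = [set 1%g].

Definition compactly_generated (G : topologicalGroupType) : Prop :=
  exists2 K : set G, compact K & generated_subgroup K = [set: G] :> set G.

Definition tdlcsc (G : topologicalGroupType) : Prop :=
  [/\ hausdorff_space G, totally_disconnected [set: G],
      locally_compact [set: G] & @second_countable G].

Definition profinite (G : topologicalGroupType) : Prop :=
  [/\ hausdorff_space G, totally_disconnected [set: G] & compact [set: G]].

Definition discrete_group (G : topologicalGroupType) : Prop :=
  forall A : set G, open A.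

Definition residual (G : topologicalGroupType) : subgroup G :=
  subgroup_bigcap [set N : subgroup G | open N /\ normal_subgroup N].

(* [f] exhibits [Q] as the topological quotient group of [G] by its kernel, so
   [elementary] below is closed under isomorphism of topological groups. *)
Definition quotient_morphism (G Q : topologicalGroupType) (f : G -> Q) : Prop :=
  [/\ {morph f : x y / x * y >-> x * y}%g, continuous f, set_surj setT setT f
    & forall U : set G, open U -> open (f @` U)].

Definition increasing_union (G : groupType) (O : nat -> subgroup G) : Prop :=
  (forall i j, (i <= j)%N -> O i `<=` O j) /\ \bigcup_i O i = [set: G].

Inductive elementary : topologicalGroupType -> Prop :=
| elementary_profinite (G : topologicalGroupType) :
    profinite G -> @second_countable G -> elementary G
| elementary_discrete (G : topologicalGroupType) :
    discrete_group G -> countable [set: G] -> elementary G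
| elementary_closed_subgroup (G : topologicalGroupType) (H : subgroup G) :
    elementary G -> closed H -> elementary (set_type H)
| elementary_quotient (G Q : topologicalGroupType) (f : G -> Q) :
    elementary G -> quotient_morphism f -> hausdorff_space Q -> elementary Q
| elementary_extension (G Q : topologicalGroupType) (f : G -> Q)
    (N : subgroup G) :
    tdlcsc G -> quotient_morphism f -> N = f @^-1` [set 1%g] :> set G ->
    elementary (set_type N) -> elementary Q -> elementary G
| elementary_union (G : topologicalGroupType) (O : nat -> subgroup G) :
    tdlcsc G -> increasing_union O ->
    (forall i, open (O i) /\ elementary (set_type (O i))) -> elementary G.

(* [xi G = Some a] means that the rank of [G] is defined and equal to [a]. These
   conditions determine the partial function [xi]; its domain of definition, which
   they do not mention, is the class [elementary]. The last clause of [rank_range]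
   says that [a] is below the first uncountable ordinal. *)
Record decomposition_rank (xi : topologicalGroupType -> option ordinal_number)
    : Prop := {
  rank_range : forall (G : topologicalGroupType) (a : ordinal_number),
    xi G = Some a ->
    [/\ tdlcsc G, (osucc ozero <= a)%O &
        countable [set b : ordinal_number | (b < a)%O]];
  rank_trivial : forall G : topologicalGroupType,
    tdlcsc G -> xi G = Some (osucc ozero) <-> trivial_group G;
  rank_defined : forall (G : topologicalGroupType) (O : nat -> subgroup G),
    tdlcsc G -> ~ trivial_group G -> increasing_union O ->
    (forall i, open (O i) /\ compactly_generated (set_type (O i))) ->
    xi G <> None <->
    forall i, xi (set_type (residual (set_type (O i)))) <> None;
  rank_sup : forall (G : topologicalGroupType) (O : nat -> subgroup G)
      (r : nat -> ordinal_number),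
    tdlcsc G -> ~ trivial_group G -> increasing_union O ->
    (forall i, open (O i) /\ compactly_generated (set_type (O i))) ->
    (forall i, xi (set_type (residual (set_type (O i)))) = Some (r i)) ->
    exists2 s, isLub (range r) s & xi G = Some (osucc s) }.

(* Main.v *)
Require Import Defs.
From mathcomp Require Import all_boot all_order all_classical topology.

(* Induct on xi(G). Some compactly generated open subgroup O of G has
   xi(O) = xi(Res(O)) + 1 >= alpha + 2. If this is not an equality, then
   R = Res(O) has rank at least alpha + 2. For a compact open subgroup U of O, the
   open subgroup RU of O contains R cocompactly and has the same rank as R, which
   is less than xi(O), so the induction hypothesis applies to RU. The equality
   xi(RU) = xi(R) rests on the following fact: if a compactly generated group N is
   normal and cocompact in W, then the elements of N in Res(W) lie in Res(N). *)

Set Implicit Arguments.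
Unset Strict Implicit.
Unset Printing Implicit Defensive.

Import Order.TTheory.

Local Open Scope classical_set_scope.
Local Open Scope group_scope.

Local Notation "x \In H" := (subgroup_set H x) (at level 70).

(** The constant [alpha + 2] leaves room for two successor steps. The rank of [G] is one more than a
    supremum of ranks of residuals, so the hypothesis bounds that supremum below by [alpha + 1]; a
    bound that is a successor is reached by a single term, whereas a limit bound need not be. Going
    back from the residual of that term to a nontrivial compactly generated open subgroup adds one
    again.

    The obstacle is that [Res(O)] is closed but in general not open in [O]: the induction could be
    run on it, but a subgroup open in [Res(O)] need not be open in [G]. Multiplying by a compact
    open [U] restores openness, and the point is that the rank does not change. One inequality is
    monotonicity under closed subgroups. The other is delicate and fails for trivial [R], where
    [RU = U] has rank 2 unless it is trivial too; it is used only for [R] of rank at least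
    [alpha + 2], hence nontrivial. *)

(** * Subgroups, generation and residuals *)

Lemma subgroup1 (G : groupType) (H : subgroup G) : 1 \In H.
Proof. by have [/set_mem] := subgroup_closed H. Qed.

Lemma subgroupF (G : groupType) (H : subgroup G) x y : x \In H -> y \In H -> x / y \In H.
Proof.
by move=> Hx Hy; apply/set_mem; have [_] := subgroup_closed H; apply; exact/mem_set.
Qed.

Lemma subgroupV (G : groupType) (H : subgroup G) x : x \In H -> x^-1 \In H.
Proof. by move=> Hx; rewrite -div1g; apply: subgroupF => //; exact: subgroup1. Qed.

Lemma subgroupM (G : groupType) (H : subgroup G) x y : x \In H -> y \In H -> x * y \In H.
Proof. by move=> Hx /subgroupV Hy; rewrite -[y]invgK; exact: subgroupF. Qed.

Lemma ex_subgroup (G : groupType) (A : set G) :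
  A 1 -> (forall x y, A x -> A y -> A (x / y)) ->
  exists H : subgroup G, H = A :> set G.
Proof.
move=> A1 AF; have cA : group_closed [in A].
  by split=> [|x y /set_mem Ax /set_mem Ay]; apply/mem_set => //; exact: AF.
by exists (Subgroup cA).
Qed.

Lemma generated_subset (G : groupType) (K : set G) : K `<=` generated_subgroup K.
Proof. by move=> x Kx H; apply. Qed.

Lemma generated_min (G : groupType) (K : set G) (H : subgroup G) :
  K `<=` H -> generated_subgroup K `<=` H.
Proof. by move=> KH x; apply. Qed.

Lemma residualP (G : topologicalGroupType) (x : G) :
  x \In residual G <->
  forall N : subgroup G, open N -> normal_subgroup N -> x \In N.
Proof. by split=> [Rx N oN nN|Rx N [oN nN]]; [exact: Rx|exact: Rx]. Qed.

Lemma residual_normal (G : topologicalGroupType) : normal_subgroup (residual G).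
Proof.
move=> x y /residualP Rx; apply/residualP => N oN nN; exact/nN/Rx.
Qed.

Lemma conjgE_div (G : groupType) (x y : G) : x ^ y = y^-1 * x * y.
Proof. by rewrite conjgE mulgA. Qed.

(** * Continuity in topological groups and open subgroups *)

Lemma continuousM (T : topologicalType) (G : topologicalGroupType) (f g : T -> G) :
  continuous f -> continuous g -> continuous (fun x => f x * g x).
Proof.
move=> cf cg x.
apply: (@continuous_comp _ _ _ (fun x => (f x, g x)) (fun ab : G * G => ab.1 * ab.2));
  last exact: mulg_continuous.
by apply: cvg_pair; [exact: cf|exact: cg].
Qed.

Lemma continuousV (T : topologicalType) (G : topologicalGroupType) (f : T -> G) :
  continuous f -> continuous (fun x => (f x)^-1).
Proof. by move=> cf x; apply: continuous_comp; [exact: cf|exact: invg_continuous]. Qed.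

Lemma continuousJ (T : topologicalType) (G : topologicalGroupType) (f g : T -> G) :
  continuous f -> continuous g -> continuous (fun x => f x ^ g x).
Proof.
move=> cf cg; rewrite (_ : (fun _ => _) = fun x => (g x)^-1 * (f x * g x)) //.
by apply: continuousM; [exact: continuousV|exact: continuousM].
Qed.

Lemma continuous_id (T : topologicalType) : continuous (@id T).
Proof. by move=> x; exact: cvg_id. Qed.

Lemma continuous_cst (T U : topologicalType) (y : U) : continuous (fun _ : T => y).
Proof. by move=> x; exact: cvg_cst. Qed.

Lemma continuous_fst (T U : topologicalType) : continuous (@fst T U).
Proof. by move=> x; exact: cvg_fst. Qed.

Lemma continuous_snd (T U : topologicalType) : continuous (@snd T U).
Proof. by move=> x; exact: cvg_snd. Qed.

Lemma continuous_nbhs (T U : topologicalType) (f : T -> U) x (A : set U) :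
  continuous f -> nbhs (f x) A -> nbhs x (f @^-1` A).
Proof. by move=> /(_ x) cf; exact: cf. Qed.

Lemma open_preimage (T U : topologicalType) (f : T -> U) (A : set U) :
  continuous f -> open A -> open (f @^-1` A).
Proof. by move=> /continuousP; apply. Qed.

Lemma closed_preimage (T U : topologicalType) (f : T -> U) (A : set U) :
  continuous f -> closed A -> closed (f @^-1` A).
Proof. by move=> cf; apply: preimage_closed => x _; exact: cf. Qed.

Lemma nbhs_mulgl (G : topologicalGroupType) (x : G) (A : set G) :
  nbhs x A <-> nbhs 1 (fun y => A (x * y)).
Proof.
have c y : continuous (fun z : G => y * z).
  exact: continuousM (@continuous_cst _ _ y) (@continuous_id _).
split=> [xA|A1].
  by apply: (continuous_nbhs (c x)); rewrite mulg1.
have : nbhs x ((fun z => x^-1 * z) @^-1` (fun y => A (x * y))).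
  by apply: (continuous_nbhs (c x^-1)); rewrite mulVg.
by apply: filterS => y /=; rewrite mulVKg.
Qed.

Lemma open_subgroup (G : topologicalGroupType) (H : subgroup G) :
  nbhs 1 H -> open H.
Proof.
move=> H1; rewrite openE => x Hx; apply/nbhs_mulgl; apply: filterS H1 => y Hy.
exact: subgroupM.
Qed.

Lemma open_nbhs1 (G : topologicalGroupType) (H : subgroup G) :
  open H -> nbhs 1 H.
Proof. by move=> oH; apply: open_nbhs_nbhs; split=> //; exact: subgroup1. Qed.

Lemma open_subgroupS (G : topologicalGroupType) (H K : subgroup G) :
  open H -> H `<=` K -> open K.
Proof. by move=> /open_nbhs1 H1 HK; apply: open_subgroup; exact: filterS H1. Qed.

Lemma open_subgroup_closed (G : topologicalGroupType) (H : subgroup G) :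
  open H -> closed H.
Proof.
move=> oH; rewrite -[X in closed X]setCK; apply: open_closedC.
rewrite openE => x nHx; apply/nbhs_mulgl.
apply: filterS (open_nbhs1 oH) => y Hy Hxy; apply: nHx.
by rewrite -(mulgK y x); exact: subgroupF.
Qed.

Lemma residual_closed (G : topologicalGroupType) : closed (residual G).
Proof. by apply: closed_bigI => N [oN _]; exact: open_subgroup_closed. Qed.

(** By compactness one neighbourhood of [s] serves all points of [K]. This is the source of every
    open set below that must behave uniformly over a compact set: stabilisers, intersections of
    conjugates, almost centralising neighbourhoods. *)
Lemma tube (T S U : topologicalType) (f : T * S -> U) (K : set T) (s : S)
    (O : set U) :
  continuous f -> compact K -> open O -> (forall x, K x -> O (f (x, s))) ->
  \forall t \near s, forall x, K x -> O (f (x, t)).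
Proof.
move=> cf /compact_near_coveringP cK oO KO.
apply: (cK _ _ (fun t x => O (f (x, t)))) => x Kx.
have : nbhs (x, s) (f @^-1` O).
  by apply: (continuous_nbhs cf); apply: open_nbhs_nbhs; split=> //; exact: KO.
by case=> -[A B] AB sAB; exists (A, B) => // -[y t] /sAB.
Qed.

(** * Homomorphisms and closed embeddings *)

Lemma morph1g (G H : groupType) (f : G -> H) :
  {morph f : x y / x * y} -> f 1 = 1.
Proof. by move=> fM; apply: (mulgI (f 1)); rewrite -fM !mulg1. Qed.

Lemma morphVg (G H : groupType) (f : G -> H) :
  {morph f : x y / x * y} -> {morph f : x / x^-1}.
Proof. by move=> fM x; apply: (mulgI (f x)); rewrite -fM !mulgV (morph1g fM). Qed.

Lemma morphJg (G H : groupType) (f : G -> H) :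
  {morph f : x y / x * y} -> {morph f : x y / x ^ y}.
Proof. by move=> fM x y; rewrite !conjgE !fM (morphVg fM). Qed.

Lemma ex_preimage_subgroup (G H : groupType) (f : G -> H) (S : subgroup H) :
  {morph f : x y / x * y} -> exists K : subgroup G, K = f @^-1` S :> set G.
Proof.
move=> fM; apply: ex_subgroup => [|x y /= Sx Sy].
  by rewrite /= (morph1g fM); exact: subgroup1.
by rewrite fM (morphVg fM); exact: subgroupF.
Qed.

Lemma ex_image_subgroup (G H : groupType) (f : G -> H) (S : subgroup G) :
  {morph f : x y / x * y} -> exists K : subgroup H, K = f @` S :> set H.
Proof.
move=> fM; apply: ex_subgroup => [|_ _ [x Sx <-] [y Sy <-]].
  by exists 1; [exact: subgroup1|exact: morph1g].
by exists (x / y); [exact: subgroupF|rewrite fM (morphVg fM)].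
Qed.

(** Maps are used rather than inclusions because a subgroup of [set_type S] and its image in the
    ambient group are distinct types for the same group. Together with continuity, [emb_nbhs] says
    that [G] carries the topology induced by [f]. *)
Record closed_embedding (G H : topologicalGroupType) (f : G -> H) : Prop := {
  embM : {morph f : x y / x * y};
  emb_inj : injective f;
  emb_cont : continuous f;
  emb_closed_range : closed (range f);
  emb_nbhs : forall x U, nbhs x U -> exists2 V, nbhs (f x) V & f @^-1` V `<=` U
}.

Definition embeds (G H : topologicalGroupType) : Prop :=
  exists f : G -> H, closed_embedding f.

Lemma valM_subgroup (G : topologicalGroupType) (S : subgroup G) :
  {morph (val : set_type S -> G) : x y / x * y}.
Proof. by move=> x y; exact: gmulfM. Qed.

Lemma val_subgroup_cont (G : topologicalGroupType) (S : subgroup G) :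
  continuous (val : set_type S -> G).
Proof. exact: initial_continuous. Qed.

Lemma val_subgroup_nbhs (G : topologicalGroupType) (S : subgroup G)
    (x : set_type S) U :
  nbhs x U -> exists2 V, nbhs (val x) V & val @^-1` V `<=` U.
Proof.
rewrite nbhsE => -[_ [[V oV <-] Vx] VU]; exists V => //.
exact: open_nbhs_nbhs.
Qed.

Lemma range_val (G : groupType) (S : subgroup G) :
  range (val : set_type S -> G) = S.
Proof.
apply/seteqP; split=> [_ [x _ <-]|x Sx]; first exact: set_valP.
by exists (exist _ x (mem_set Sx)).
Qed.

Lemma val_embedding (G : topologicalGroupType) (S : subgroup G) :
  closed S -> closed_embedding (val : set_type S -> G).
Proof.
move=> cS; split; [exact: valM_subgroup|exact: val_inj|exact: val_subgroup_cont| |].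
- by rewrite range_val.
- exact: val_subgroup_nbhs.
Qed.

Lemma embedding_closed (G H : topologicalGroupType) (f : G -> H) (C : set G) :
  closed_embedding f -> closed C -> closed (f @` C).
Proof.
move=> ef cC y cly.
have [x _ yE] : range f y.
  by apply: (emb_closed_range ef); apply: closureS cly; exact: image_subset.
exists x => //; apply: cC => U /(emb_nbhs ef)[V]; rewrite yE => /cly[_ [[z Cz <-] Vz]].
by move=> VU; exists z; split=> //; exact: VU.
Qed.

Lemma embedding_comp (G H K : topologicalGroupType) (f : G -> H) (g : H -> K) :
  closed_embedding f -> closed_embedding g -> closed_embedding (g \o f).
Proof.
move=> ef eg; split.
- by move=> x y /=; rewrite (embM ef) (embM eg).
- by move=> x y /= /(emb_inj eg)/(emb_inj ef).
- by move=> x; apply: continuous_comp; [exact: (emb_cont ef)|exact: (emb_cont eg)].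
- by have := embedding_closed eg (emb_closed_range ef); rewrite image_comp.
- move=> x U /(emb_nbhs ef)[V /(emb_nbhs eg)[W fW WV] VU]; exists W => // y /= /WV.
  exact: VU.
Qed.

Lemma embedding_factor (G H : topologicalGroupType) (S : subgroup H) (f : G -> H) :
  closed_embedding f -> (forall x, f x \In S) ->
  exists2 g : G -> set_type S, closed_embedding g & forall x, val (g x) = f x.
Proof.
move=> ef fS; pose g x : set_type S := exist _ (f x) (mem_set (fS x)).
exists g => //; split.
- by move=> x y; apply: val_inj; rewrite valM_subgroup /=; exact: (embM ef).
- by move=> x y /(congr1 val)/(emb_inj ef).
- move=> x U /val_subgroup_nbhs[V fV VU].
  have := continuous_nbhs (emb_cont ef) fV.
  by apply: filterS => y fy; exact: VU.
- have -> : range g = val @^-1` range f.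
    apply/seteqP; split=> [_ [x _ <-]|y [x _ xy]]; first by exists x.
    by exists x => //; exact: val_inj.
  exact: closed_preimage (@val_subgroup_cont _ S) (emb_closed_range ef).
- move=> x U /(emb_nbhs ef)[V fV VU]; exists (val @^-1` V) => //.
  exact: continuous_nbhs (@val_subgroup_cont _ S) (_ : nbhs (val (g x)) V).
Qed.

(** Open normal subgroups pull back to open normal subgroups. This monotonicity of the residual is
    what makes the rank monotone. *)
Lemma embedding_residual (G H : topologicalGroupType) (f : G -> H) :
  closed_embedding f -> forall x, x \In residual G -> f x \In residual H.
Proof.
move=> ef x /residualP Rx; apply/residualP => N oN nN.
have [M ME] := ex_preimage_subgroup N (embM ef).
have: x \In M; last by rewrite ME.
apply: Rx => [|y z]; rewrite ME.
  exact: open_preimage (emb_cont ef) oN.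
by rewrite /= (morphJg (embM ef)); exact: nN.
Qed.

Lemma embeds_residual (G H : topologicalGroupType) :
  embeds G H -> embeds (set_type (residual G)) (set_type (residual H)).
Proof.
move=> [f ef].
have [x|g eg _] := @embedding_factor (set_type (residual G)) _ (residual H) (f \o val)
  (embedding_comp (val_embedding (@residual_closed G)) ef).
  exact: (@embedding_residual _ _ f ef (val x) (set_valP x)).
by exists g.
Qed.

(** Since the range is closed, a cluster point in [K] of the image filter comes from [G], and
    [emb_nbhs] makes its preimage a cluster point of the original filter. *)
Lemma embedding_compact (G H : topologicalGroupType) (f : G -> H) (K : set H) :
  closed_embedding f -> compact K -> compact (f @^-1` K).
Proof.
move=> ef cK F PF FK.
have [|y [Ky cly]] := cK (f @ F) _; first exact: FK.
have [x _ yE] : range f y.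
  apply: (emb_closed_range ef) => V yV; apply: cly yV.
  by rewrite /fmap /=; apply: filterS FK => x _; exists x.
exists x; split=> [|A U FA /(emb_nbhs ef)[V]]; first by rewrite /= yE.
rewrite yE => /(cly (f @` A))[|_ [[z Az <-] Vz] VU].
  by rewrite /fmap /=; apply: filterS FA => z Az; exists z.
by exists z; split=> //; exact: VU.
Qed.

Lemma embedding_tdlcsc (G H : topologicalGroupType) (f : G -> H) :
  closed_embedding f -> tdlcsc H -> tdlcsc G.
Proof.
move=> ef [hH tH lH [B cB [oB nB]]]; split.
- move=> x y xy; apply: (emb_inj ef); apply: hH => U V.
  move=> /(continuous_nbhs (emb_cont ef)) fU /(continuous_nbhs (emb_cont ef)) fV.
  by have [z [Uz Vz]] := xy _ _ fU fV; exists (f z).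
- move=> x _; apply/seteqP; split=> [y [C [Cx _ cC] Cy]|_ ->]; last first.
    exact: connected_component_refl.
  apply: (emb_inj ef); apply: esym.
  suff : connected_component [set: H] (f x) (f y) by rewrite tH // => ->.
  exists (f @` C); last by exists y.
  split=> //.
  apply: (connected_continuous_connected cC); apply: continuous_subspaceT.
  exact: (emb_cont ef).
- move=> x _; have [U fxU [cU clU]] := lH (f x) Logic.I.
  exists (f @^-1` U); last split.
  + have {}fxU : nbhs (f x) U by move: fxU; rewrite /within /=; apply: filterS => y; exact.
    by have := continuous_nbhs (emb_cont ef) fxU; apply: filterS => y Uy _.
  + exact: embedding_compact.
  + exact: closed_preimage (emb_cont ef) clU.
- exists [set f @^-1` U | U in B]; first exact: card_le_trans (card_image_le _ _) cB.
  split=> [_ [U BU <-]|x U /(emb_nbhs ef)[V /nB[W [BW Wx] WV] VU]].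
    exact: open_preimage (emb_cont ef) (oB _ BU).
  by exists (f @^-1` W); [split=> //; exists W|move=> y /WV/VU].
Qed.

(** * Compact open subgroups *)

Lemma continuous_div (G : topologicalGroupType) :
  continuous (fun xy : G * G => xy.1 / xy.2).
Proof.
have cV : continuous (fun xy : G * G => xy.2^-1).
  exact: continuousV (@continuous_snd G G).
exact: continuousM (@continuous_fst G G) cV.
Qed.

(* The intersection Q of the relatively clopen subsets of K containing 1 is
   connected, hence equal to {1}; by compactness one of them lies in V. *)
Lemma compact_open_nbhs (G : topologicalGroupType) (K V : set G) :
  hausdorff_space G -> totally_disconnected [set: G] -> compact K ->
  nbhs 1 K -> nbhs 1 V ->
  exists C : set G, [/\ compact C, open C, C 1 & C `<=` V].
Proof.
move=> hG tG cK K1 V1.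
have clK : closed K by exact: compact_closed.
pose P (C : set G) := [/\ C `<=` K, closed C, closed (K `\` C) & C 1].
have PK : P K.
  by split=> //; [rewrite setDv; exact: closed0|exact: nbhs_singleton].
have PI C D : P C -> P D -> P (C `&` D).
  move=> [CK cC cKC C1] [DK cD cKD D1]; split=> //.
  - by move=> x [/CK].
  - exact: closedI.
  - by rewrite setDIr; exact: closedU.
pose Q := \bigcap_(C in P) C.
(* Compactness of [K]: otherwise the sets [C] minus [O], for [C] in [P], generate a proper filter,
   and its cluster point lies in [Q] but outside [O]. *)
have PO O : open O -> Q `<=` O -> exists2 C, P C & C `<=` O.
  move=> oO QO; apply: contrapT => nPO.
  have FF : ProperFilter (filter_from P (fun C => C `\` O)).
    apply: filter_from_proper; last first.
      move=> C PC; apply/set0P/eqP; rewrite setD_eq0 => CO.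
      by apply: nPO; exists C.
    apply: filter_from_filter; first by exists K.
    move=> C D PC PD; exists (C `&` D); first exact: PI.
    by move=> x [[]].
  have [|p [Kp clp]] := cK _ FF; first by exists K => // x [].
  have: Q p.
    move=> C PC; have [_ cC _ _] := PC; apply: cC => W pW.
    have [|z [Cz Wz]] := clp C W _ pW; last by exists z.
    by exists C => // x [].
  move=> /QO Op; have pO : nbhs p O by exact: open_nbhs_nbhs.
  have [|z [nOz Oz]] := clp (~` O) O _ pO; last by [].
  by exists K => // x [].
have cQ : closed Q by apply: closed_bigI => C [].
(* As [A] is compact and [B] closed, some neighbourhood [W] of [1] makes the open thickenings [AW]
   and [BW] disjoint. Some [C] in [P] lies in their union, so its part in [AW] is also its part
   outside [BW], hence again a member of [P]. Thus [Q] lies in [AW] and [B] is empty. *)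
have sep A B : closed A -> closed B -> Q = A `|` B -> A `&` B = set0 -> A 1 ->
    B = set0.
  move=> cA cB QE AB0 A1.
  have cptA : compact A.
    apply: (subclosed_compact cA cK) => x Ax.
    by have : Q x by [rewrite QE; left]; apply.
  have W1 : \forall t \near (1 : G), forall x, A x -> (~` B) (x * t).
    apply: (@tube _ _ _ (fun xt : G * G => xt.1 * xt.2)) => //.
    - exact: mulg_continuous.
    - exact: closed_openC.
    - by move=> x Ax Bx; rewrite /= mulg1 in Bx; have : (A `&` B) x by []; rewrite AB0.
  have cdiv := @continuous_div G.
  have [[U1 U2] /= [U11 U21] UU] : nbhs ((1, 1) : G * G)
      (fun xy => forall x, A x -> (~` B) (x * (xy.1 / xy.2))).
    by apply: (continuous_nbhs cdiv (A := fun t => forall x, A x -> (~` B) (x * t)));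
      rewrite /= divg1.
  have [W [oW Ww WU]] : exists W : set G, [/\ open W, W 1 & W `<=` U1 `&` U2].
    have : nbhs (1 : G) (U1 `&` U2) by exact: filterI.
    by rewrite nbhsE => -[W [oW Ww] WU]; exists W.
  pose thick (D : set G) := \bigcup_(d in D) [set y | W (d^-1 * y)].
  have othick D : open (thick D).
    apply: bigcup_open => d _; apply: (open_preimage _ oW).
    exact: continuousM (@continuous_cst _ _ _) (@continuous_id _).
  have sthick D : D `<=` thick D by move=> d Dd; exists d => //=; rewrite mulVg.
  have dis x : thick A x -> thick B x -> False.
    move=> [a Aa /= /WU[wa _]] [b Bb /= /WU[_ wb]].
    apply: (UU (a^-1 * x, b^-1 * x) (conj wa wb) a Aa).
    by rewrite /= invgM invgK -mulgA !mulVKg.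
  have QAB : Q `<=` thick A `|` thick B.
    by rewrite QE => x [/sthick|/sthick]; [left|right].
  have [C [CK cC cKC C1] CAB] := PO _ (openU (othick A) (othick B)) QAB.
  have PCA : P (C `&` thick A).
    split=> [x []| | |]; [by move=> /CK| | |by split=> //; exact: sthick].
    - rewrite (_ : _ `&` _ = C `&` ~` thick B).
        by apply: closedI => //; exact/open_closedC.
      apply/seteqP; split=> x [Cx]; first by move=> Ax; split=> // /(dis _ Ax).
      by move=> nB; split=> //; case: (CAB _ Cx).
    - rewrite (_ : _ `\` _ = (K `\` C) `|` (C `&` ~` thick A)).
        by apply: closedU => //; apply: closedI => //; exact/open_closedC.
      apply/seteqP; split=> x.
        move=> [Kx nCA]; have [Cx|nCx] := pselect (C x); last by left.
        by right; split=> // Ax; exact: nCA.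
      by move=> [[Kx nCx]|[Cx nAx]]; split=> //; [case|exact: CK|case].
  rewrite -subset0 => x Bx.
  have [_ Ax] : (C `&` thick A) x by have : Q x by [rewrite QE; right]; apply.
  exact: dis Ax (sthick _ _ Bx).
have Q1 : Q 1 by move=> C [].
have conQ : connected Q.
  move=> B [b Bb] [O oO BO] [D cD BD].
  have cB : closed B by rewrite BD; exact: closedI.
  have cQB : closed (Q `&` ~` O) by apply: closedI => //; exact/open_closedC.
  have QE : Q = B `|` (Q `&` ~` O).
    rewrite BO; apply/seteqP; split=> [x Qx|x [[]//|[]//]].
    by have [Ox|nOx] := pselect (O x); [left|right].
  have dis : B `&` (Q `&` ~` O) = set0.
    by rewrite BO -subset0 => x [[_ Ox] [_ nOx]].
  have [B1|nB1] := pselect (B 1).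
    by rewrite QE (sep _ _ cB cQB QE dis B1) setU0.
  have : B = set0.
    apply: (sep (Q `&` ~` O) B) => //; [by rewrite setUC|by rewrite setIC|].
    by split=> // O1; apply: nB1; rewrite BO.
  by move=> B0; rewrite B0 in Bb.
have QS : Q `<=` [set 1].
  move=> x Qx; have : connected_component [set: G] 1 x by exists Q.
  by rewrite tG.
have : nbhs (1 : G) (V `&` K) by exact: filterI.
rewrite nbhsE => -[W [oW W1] WVK].
have QW : Q `<=` W by move=> x /QS ->.
have [C [CK cC cKC C1] CW] := PO W oW QW.
exists C; split=> //; last by move=> x /CW/WVK[].
  exact: subclosed_compact cC cK CK.
(* Relatively clopen becomes open because [C] lies in the open set [W] inside [K]: it is [W] minus
   the closed set of points of [K] outside [C]. *)
rewrite (_ : C = W `&` ~` (K `\` C)); first by apply: openI => //; exact/closed_openC.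
apply/seteqP; split=> x; first by move=> Cx; split; [exact: CW|move=> []].
by move=> [/WVK[_ Kx] nKC]; apply: contrapT => nCx; apply: nKC.
Qed.

(* van Dantzig's theorem *)
Lemma ex_compact_open_subgroup (G : topologicalGroupType) (V : set G) :
  tdlcsc G -> nbhs 1 V ->
  exists U : subgroup G, [/\ compact U, open U & U `<=` V].
Proof.
move=> [hG tG lG _] V1.
have [K K1 [cK _]] := lG 1 Logic.I.
have {}K1 : nbhs 1 K by move: K1; rewrite /within /=; apply: filterS => y; exact.
have [C [cC oC C1 CV]] := compact_open_nbhs hG tG cK K1 V1.
(* The stabiliser of [C] under right translation. It lies in [C] because [1] does, and it is open by
   [tube]. *)
have [|x y Ux Uy|U UE] := @ex_subgroup G
    [set t | forall c, C c -> C (c * t) /\ C (c * t^-1)].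
- by move=> c Cc; rewrite invg1 mulg1.
- by move=> c Cc; rewrite invgF !mulgA; split; [apply: (Uy _ _).2; exact: (Ux _ _).1|
    apply: (Ux _ _).2; exact: (Uy _ _).1].
have UC : U `<=` C.
  by rewrite UE => x /(_ 1 C1)[]; rewrite mul1g.
have oU : open U.
  apply: open_subgroup; rewrite UE.
  have cid1 : continuous (fun xt : G * G => xt.1 * xt.2) by exact: mulg_continuous.
  have cid2 := @continuous_div G.
  have C1x c : C c -> C ((c, 1 : G).1 * (c, 1 : G).2) by rewrite mulg1.
  have C1V c : C c -> C ((c, 1 : G).1 / (c, 1 : G).2) by rewrite divg1.
  have h1 := tube cid1 cC oC C1x.
  have h2 := tube cid2 cC oC C1V.
  by apply: filterS2 h1 h2 => t h1 h2 c Cc; split; [exact: h1|exact: h2].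
exists U; split=> //; last by move=> x /UC/CV.
by apply: subclosed_compact cC UC; exact: open_subgroup_closed.
Qed.

(** Take the elements all of whose [U]-conjugates lie in a compact open subgroup [M] inside [V];
    compactness of [U] keeps this intersection open. *)
Lemma ex_normal_core (G : topologicalGroupType) (U : subgroup G) (V : set G) :
  tdlcsc G -> compact U -> nbhs 1 V ->
  exists L : subgroup G, [/\ open L, L `<=` V &
    forall x u, x \In L -> u \In U -> x ^ u \In L].
Proof.
move=> tG cU V1; have [M [_ oM MV]] := ex_compact_open_subgroup tG V1.
have [|x y Mx My|L LE] := @ex_subgroup G [set x | forall u, u \In U -> x ^ u \In M].
- by move=> u _; rewrite conj1g; exact: subgroup1.
- by move=> u Uu; rewrite conjMg conjVg; apply: subgroupF; [exact: Mx|exact: My].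
exists L; split.
- apply: open_subgroup; rewrite LE.
  have cJ : continuous (fun ux : G * G => ux.2 ^ ux.1).
    exact: continuousJ (@continuous_snd G G) (@continuous_fst G G).
  have M1 u : u \In U -> (u, 1 : G).2 ^ (u, 1 : G).1 \In M.
    by move=> _; rewrite conj1g; exact: subgroup1.
  exact: tube cJ cU oM M1.
- by rewrite LE => x /(_ 1 (subgroup1 U)); rewrite conjg1 => /MV.
- move=> x u; rewrite LE => Mx Uu v Uv; rewrite -conjgM; apply: Mx.
  exact: subgroupM.
Qed.

(** * Products of subgroups and compact generation *)

Lemma ex_subgroup_mul (G : groupType) (Q U : subgroup G) :
  (forall q u, q \In Q -> u \In U -> q ^ u \In Q) ->
  exists W : subgroup G, W = [set q * u | q in Q & u in U] :> set G.
Proof.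
move=> QU; apply: ex_subgroup.
  by exists 1; [exact: subgroup1|exists 1; [exact: subgroup1|rewrite mulg1]].
move=> _ _ [q Qq [u Uu <-]] [r Qr [v Uv <-]].
have Uuv : u / v \In U by exact: subgroupF.
(* With [w = u / v], the quotient is [q * w * r^-1], and moving [w] to the right conjugates [r^-1]
   by [w^-1]. *)
exists (q * (r^-1) ^ (u / v)^-1).
  by apply: subgroupM => //; apply: QU; exact: subgroupV.
exists (u / v) => //.
have -> : q * u / (r * v) = q * (u / v) / r by rewrite invgM !mulgA.
by move: (u / v) => w; rewrite conjgE_div invgK !mulgA mulgVK.
Qed.

Lemma sub_mull (G : groupType) (Q U : subgroup G) :
  Q `<=` [set q * u | q in Q & u in U].
Proof. by move=> q Qq; exists q => //; exists 1; [exact: subgroup1|rewrite mulg1]. Qed.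

Lemma sub_mulr (G : groupType) (Q U : subgroup G) :
  U `<=` [set q * u | q in Q & u in U].
Proof. by move=> u Uu; exists 1; [exact: subgroup1|exists u; rewrite ?mul1g]. Qed.

Lemma generated_conj (G : groupType) (K : set G) (u : G) :
  (forall x, K x -> K (x ^ u)) ->
  forall x, x \In generated_subgroup K -> x ^ u \In generated_subgroup K.
Proof.
move=> KJ; have [S SE] := ex_preimage_subgroup (f := conjg^~ u) (generated_subgroup K)
  (fun x y => conjMg x y u).
suff : generated_subgroup K `<=` S by rewrite SE.
by apply: generated_min; rewrite SE => x /KJ Kx; exact: generated_subset.
Qed.

(** Allows generators to be given in the ambient group [H] when [G] is a nested subgroup type. *)
Lemma compactly_generated_range (G H : topologicalGroupType) (f : G -> H)
    (K : set H) :
  closed_embedding f -> compact K -> generated_subgroup K = range f :> set H ->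
  compactly_generated G.
Proof.
move=> ef cK KE; exists (f @^-1` K); first exact: embedding_compact ef cK.
apply/seteqP; split=> // x _ T KT.
have [S SE] := ex_image_subgroup T (embM ef).
have : generated_subgroup K `<=` S.
  apply: generated_min => k Kk; rewrite SE.
  have [y _ yk] : range f k by rewrite -KE; exact: generated_subset.
  by exists y => //; apply: KT; rewrite /= yk.
have fx : range f (f x) by exists x.
rewrite KE => /(_ _ fx); rewrite SE => -[y Ty /(emb_inj ef) <-].
exact: Ty.
Qed.

Lemma compactly_generated_subgroup (G : topologicalGroupType) (S : subgroup G)
    (K : set G) :
  closed S -> compact K -> generated_subgroup K = S :> set G ->
  compactly_generated (set_type S).
Proof.
move=> cS cK KS; apply: compactly_generated_range (val_embedding cS) cK _.
by rewrite range_val.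
Qed.

Lemma compactly_generated_image (G H : topologicalGroupType) (f : G -> H) :
  {morph f : x y / x * y} -> continuous f -> (forall y, range f y) ->
  compactly_generated G -> compactly_generated H.
Proof.
move=> fM cf sf [K cK KT]; exists (f @` K).
  by apply: continuous_compact => //; exact: continuous_subspaceT.
apply/seteqP; split=> // y _ T KfT; have [x _ <-] := sf y.
have [S SE] := ex_preimage_subgroup T fM.
have : generated_subgroup K `<=` S.
  by apply: generated_min => k Kk; rewrite SE; apply: KfT; exists k.
by rewrite KT SE; apply.
Qed.

(** * Exhaustions by compactly generated subgroups *)

(** A point of [R] is picked in each member of a countable base that meets [R], with [1] as default
    for the remaining indices; the left translates of [U] by these points cover [R]. *)
Lemma ex_dense_sequence (G : topologicalGroupType) (R U : subgroup G) :
  @second_countable G -> open U ->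
  exists x : nat -> G, (forall k, x k \In R) /\
    forall r, r \In R -> exists k, (x k)^-1 * r \In U.
Proof.
move=> [B cB [oB nB]] oU; have /countable_injP[f fB] := cB.
have /choice[x xP] : forall k, exists x, x \In R /\
    forall b, B b -> f b = k -> b `&` R !=set0 -> b x.
  move=> k; have [[b [Bb fb [x [bx Rx]]]]|nb] :=
    pselect (exists b, [/\ B b, f b = k & b `&` R !=set0]).
    exists x; split=> // c Bc fc _; suff <- : b = c by [].
    by apply: fB; rewrite ?inE // fb fc.
  exists 1; split; first exact: subgroup1.
  by move=> b Bb fb bR; case: nb; exists b.
exists x; split=> [k|r Rr]; first by have [] := xP k.
have : nbhs r [set y | y^-1 * r \In U].
  have c : continuous (fun y : G => y^-1 * r).
    exact: continuousM (continuousV (@continuous_id G)) (@continuous_cst _ _ r).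
  by apply: (continuous_nbhs c (A := U)); rewrite mulVg; exact: open_nbhs1.
move=> /nB[b [Bb br] bU]; exists (f b).
by have [_ /(_ b Bb erefl) xb] := xP (f b); apply: bU; apply: xb; exists r.
Qed.

(** [Q i] is generated by the part of [R] in [U] and all [U]-conjugates of [x 0], ..., [x i]. This
    set is compact because [U] is, and it is invariant under [U], so that the products of [Q i] with
    [U] are subgroups. Taking for [R] the whole group gives the exhaustions needed for the rank. *)
Lemma normal_exhaustion (G : topologicalGroupType) (R U : subgroup G) :
  tdlcsc G -> closed R -> normal_subgroup R -> compact U -> open U ->
  exists (Q : nat -> subgroup G) (K : nat -> set G),
    [/\ forall i, compact (K i) /\ generated_subgroup (K i) = Q i :> set G,
        forall i, R `&` U `<=` Q i /\ Q i `<=` R,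
        forall i q u, q \In Q i -> u \In U -> q ^ u \In Q i,
        forall i j, (i <= j)%N -> Q i `<=` Q j
      & \bigcup_i Q i = R].
Proof.
move=> [_ _ _ sG] cR nR cU oU; have [x [xR xU]] := ex_dense_sequence R sG oU.
pose K i := (R `&` U) `|` \bigcup_(k < i.+1) [set x k ^ u | u in U].
pose Q i := generated_subgroup (K i).
have KQ i : K i `<=` Q i by exact: generated_subset.
have RUK i : R `&` U `<=` K i by move=> y; left.
have KR i : K i `<=` R by move=> y [[]//|[k _ [u _ <-]]]; exact: nR.
have QR i : Q i `<=` R by exact: generated_min.
have Qx i k : (k <= i)%N -> x k \In Q i.
  move=> ki; apply: KQ; right; exists k => //.
  by exists 1; [exact: subgroup1|rewrite conjg1].
exists Q, K; split.
- move=> i; split=> //; apply: compactU.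
    by rewrite setIC; exact: compact_closedI.
  rewrite bigcup_mkord; apply: bigsetU_compact => k _.
  apply: continuous_compact => //; apply: continuous_subspaceT.
  exact: continuousJ (@continuous_cst _ _ _) (@continuous_id G).
- by move=> i; split=> // y /RUK/KQ.
- move=> i q u Qq Uu; move: q Qq; apply: generated_conj => y.
  move=> [[Ry Uy]|[k ki [v Uv <-]]].
    left; split; first exact: nR.
    by rewrite conjgE; apply: subgroupM; [exact: subgroupV|exact: subgroupM].
  right; exists k => //; exists (v * u); first exact: subgroupM.
  by rewrite conjgM.
- move=> i j ij; apply: generated_min => y Ky; apply: KQ.
  case: Ky => [|[k ki ky]]; first by left.
  by right; exists k => //=; exact: leq_trans ki _.
- apply/seteqP; split=> [y [i _ /QR]//|r Rr]; have [k xr] := xU r Rr.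
  exists k => //; rewrite -[r](mulVKg (x k)); apply: subgroupM; first exact: Qx.
  apply/KQ/RUK; split=> //.
  by apply: subgroupM => //; exact: subgroupV.
Qed.

Lemma ex_exhaustion (G : topologicalGroupType) :
  tdlcsc G -> exists O : nat -> subgroup G, increasing_union O /\
    forall i, open (O i) /\ compactly_generated (set_type (O i)).
Proof.
move=> tG; have [U [cU oU _]] := ex_compact_open_subgroup tG (@filterT _ (nbhs (1 : G)) _).
have [|//|R RE] := @ex_subgroup G setT; first by [].
have [|x y _|Q [K [KQ QU _ Qm Qu]]] := normal_exhaustion (R := R) tG _ _ cU oU.
- by rewrite RE; exact: closedT.
- by rewrite RE.
exists Q; split=> [|i]; first by split=> //; rewrite Qu RE.
have oQ : open (Q i).
  by apply: open_subgroupS oU _ => x Ux; apply: (QU i).1; rewrite RE.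
split=> //; have [cK KE] := KQ i.
exact: compactly_generated_subgroup (open_subgroup_closed oQ) cK KE.
Qed.

(** * Monotonicity of the rank and the cocompact case *)

Lemma ltoSE (a b : ordinal_number) : (a < osucc b)%O = (a <= b)%O.
Proof. by rewrite ltNge osucc_le -leNgt. Qed.

Lemma leoSE (a b : ordinal_number) : (osucc a <= osucc b)%O = (a <= b)%O.
Proof. by rewrite osucc_le ltoSE. Qed.

Lemma id_embedding (G : topologicalGroupType) : closed_embedding (@id G).
Proof.
split=> //; first exact: continuous_id.
by move=> x U xU; exists U.
Qed.

Lemma compact_sub_union (T : topologicalType) (G : topologicalGroupType)
    (g : T -> G) (K : set T) (O : nat -> subgroup G) :
  continuous g -> compact K -> increasing_union O -> (forall i, open (O i)) ->
  exists n, forall x, K x -> g x \In O n.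
Proof.
move=> cg /compact_near_coveringP cK [Om Ou] oO.
have : \forall n \near \oo, K `<=` (fun x => g x \In O n).
  apply: cK => x _; have [m _ gm] : (\bigcup_i O i) (g x) by rewrite Ou.
  exists (g @^-1` O m, [set n | (m <= n)%N]); last first.
    by move=> [y n] /= [yO mn]; exact: Om yO.
  split; last by exists m.
  by apply: (continuous_nbhs cg); apply: open_nbhs_nbhs.
by move=> /filter_ex[n Kn]; exists n.
Qed.

(** A compact generating set is mapped into a single [O n], and the whole group follows it there. *)
Lemma compactly_generated_embeds (G H : topologicalGroupType) (f : G -> H)
    (O : nat -> subgroup H) :
  closed_embedding f -> compactly_generated G -> increasing_union O ->
  (forall i, open (O i)) -> exists n, embeds G (set_type (O n)).
Proof.
move=> ef [K cK KT] uO oO.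
have [n Kn] := compact_sub_union (emb_cont ef) cK uO oO.
have [S SE] := ex_preimage_subgroup (O n) (embM ef).
have KS : generated_subgroup K `<=` S by apply: generated_min; rewrite SE.
have fO x : f x \In O n.
  have : x \In S by apply: KS; rewrite KT.
  by rewrite SE.
by have [g eg _] := embedding_factor ef fO; exists n, g.
Qed.

(* Applied in both directions, this also gives the invariance of the rank under
   isomorphism, which [decomposition_rank] does not postulate. *)
Lemma rank_embeds (xi : topologicalGroupType -> option ordinal_number)
    (G H : topologicalGroupType) (h : ordinal_number) :
  decomposition_rank xi -> embeds G H -> xi H = Some h ->
  exists2 g, xi G = Some g & (g <= h)%O.
Proof.
move=> rk; move: G H; elim/Defs.ordinal_ind: h => h IH G H [f ef] xiH.
have [tH h1 _] := rank_range rk xiH.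
have tG := embedding_tdlcsc ef tH.
have [trG|ntG] := pselect (trivial_group G).
  by exists (osucc ozero) => //; apply/(rank_trivial rk tG).
have ntH : ~ trivial_group H.
  move=> trH; apply: ntG; apply/seteqP; split=> // x _; apply: (emb_inj ef).
  rewrite (morph1g (embM ef)).
  have : [set: H] (f x) by [].
  by rewrite trH.
have [O [uO cgO]] := ex_exhaustion tH.
have [P [uP cgP]] := ex_exhaustion tG.
have /choice[r rE] : forall i, exists r,
    xi (set_type (residual (set_type (O i)))) = Some r.
  move=> i; have /(rank_defined rk tH ntH uO cgO)/(_ i) : xi H <> None by rewrite xiH.
  by case: (xi _) => [r|//] _; exists r.
have [s [ubs _]] := rank_sup rk tH ntH uO cgO rE.
rewrite xiH => -[hE].
have rs i : (r i <= s)%O by apply: ubs; exists i.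
(* Each [P i] embeds in some [O n], hence its residual in that of [O n], whose rank [r n] is at most
   [s] and so below [h]: the induction hypothesis gives both definedness and the bound. *)
have /choice[a aP] : forall i, exists a,
    xi (set_type (residual (set_type (P i)))) = Some a /\ (a <= s)%O.
  move=> i; have [oP cP] := cgP i.
  have eP := embedding_comp (val_embedding (open_subgroup_closed oP)) ef.
  have [n /embeds_residual en] := compactly_generated_embeds eP cP uO (fun j => (cgO j).1).
  have [|a xia ar] := IH (r n) _ _ _ en (rE n); first by rewrite hE ltoSE.
  by exists a; split=> //; exact: le_trans ar (rs n).
have aE i : xi (set_type (residual (set_type (P i)))) = Some (a i) by have [] := aP i.
have [t [_ lt] xiG] := rank_sup rk tG ntG uP cgP aE.
exists (osucc t) => //; rewrite hE leoSE; apply: lt => _ [i _ <-].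
by have [] := aP i.
Qed.

Lemma rank_iso (xi : topologicalGroupType -> option ordinal_number)
    (G H : topologicalGroupType) (h : ordinal_number) :
  decomposition_rank xi -> embeds G H -> embeds H G -> xi H = Some h ->
  xi G = Some h.
Proof.
move=> rk GH HG xiH; have [g xiG gh] := rank_embeds rk GH xiH.
have [h' ] := rank_embeds rk HG xiG; rewrite xiH => -[<-] hg.
by rewrite xiG; congr Some; apply: le_anti; rewrite gh.
Qed.

(** The constant sequence is an admissible exhaustion, so the supremum is a single value. [T] is all
    of [G] as a subgroup; its type is only isomorphic to [G], whence [rank_iso]. *)
Lemma rank_compactly_generated
    (xi : topologicalGroupType -> option ordinal_number)
    (G : topologicalGroupType) (g : ordinal_number) :
  decomposition_rank xi -> ~ trivial_group G -> compactly_generated G ->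
  xi G = Some g ->
  exists2 r, xi (set_type (residual G)) = Some r & g = osucc r.
Proof.
move=> rk ntG cG xiG; have [tG _ _] := rank_range rk xiG.
have [//|//|T TE] := @ex_subgroup G setT.
have oT : open T by rewrite TE; exact: openT.
have cT := open_subgroup_closed oT.
have cgT : compactly_generated (set_type T).
  by have [K cK KT] := cG; apply: (compactly_generated_subgroup cT cK); rewrite KT TE.
have uT : increasing_union (fun _ : nat => T).
  split=> [i j _|]; first exact: subset_refl.
  by apply/seteqP; split=> // x _; exists 0%N; rewrite ?TE.
have GT : embeds G (set_type T).
  have [|f ef _] := @embedding_factor G G T id (@id_embedding G); last by exists f.
  by rewrite TE.
have TG : embeds (set_type T) G by exists val; exact: val_embedding.
have : xi (set_type (residual (set_type T))) <> None.
  apply: (rank_defined rk tG ntG uT (fun _ => conj oT cgT)).1 0%N.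
  by rewrite xiG.
case xiT : (xi _) => [r|//] _.
have [s [ubs lbs] ] := rank_sup rk tG ntG uT (fun _ => conj oT cgT) (fun _ => xiT).
rewrite xiG => -[->]; exists r.
  exact: rank_iso rk (embeds_residual GT) (embeds_residual TG) xiT.
congr osucc; apply: le_anti; apply/andP; split.
  by apply: lbs => _ [i _ <-].
by apply: ubs; exists 0%N.
Qed.

(* The intersection D1 of the conjugates of D is open in N since U is compact.
   As N is compactly generated, a small open subgroup L normalised by U
   centralises N modulo D1, so E = D1 L is normal; moreover E meets N in D1. *)
Lemma extend_open_normal (W : topologicalGroupType) (N U : subgroup W)
    (D : subgroup (set_type N)) :
  tdlcsc W -> normal_subgroup N -> compactly_generated (set_type N) ->
  compact U -> open U ->
  (forall w, exists n u, [/\ n \In N, u \In U & w = n * u]) ->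
  open D -> normal_subgroup D ->
  exists E : subgroup W, [/\ open E, normal_subgroup E &
    forall n : set_type N, val n \In E -> n \In D].
Proof.
move=> tW nN [K cK KT] cU oU NU oD nD.
have {}NU w : exists u n, [/\ u \In U, n \In N & w = u * n].
  have [n [u [Nn Uu ->]]] := NU w; exists u, (n ^ u).
  by split=> //; [exact: nN|rewrite conjgE mulVKg].
have [A oA AD] : exists2 A : set W, open A & val @^-1` A = D by case: oD => A; exists A.
have D1N n : (n \In D) = A (val n) by rewrite -AD.
have [D0 D0E] := ex_image_subgroup D (@valM_subgroup _ N).
have D0P x : x \In N -> A x -> x \In D0.
  move=> Nx Ax; rewrite D0E; exists (exist _ x (mem_set Nx)) => //.
  by rewrite D1N.
have D0N x : x \In D0 -> x \In N by rewrite D0E => -[y _ <-]; exact: set_valP.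
have D0J x n : x \In D0 -> n \In N -> x ^ n \In D0.
  rewrite D0E => -[y Dy <-] Nn; exists (y ^ (exist _ n (mem_set Nn))).
    exact: nD.
  by rewrite (morphJg (@valM_subgroup _ N)).
have [|x y Dx Dy|D1 D1E] := @ex_subgroup W [set x | forall w, x ^ w \In D0].
- by move=> w; rewrite conj1g; exact: subgroup1.
- by move=> w; rewrite conjMg conjVg; exact: subgroupF.
have D1D0 x : x \In D1 -> x \In D0 by rewrite D1E => /(_ 1); rewrite conjg1.
have D1J x w : x \In D1 -> x ^ w \In D1.
  by rewrite D1E => Dx v; rewrite -conjgM; exact: Dx.
have cJ : continuous (fun ux : W * W => ux.2 ^ ux.1).
  exact: continuousJ (@continuous_snd W W) (@continuous_fst W W).
have A1 u : u \In U -> A ((u, 1 : W).2 ^ (u, 1 : W).1).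
  by move=> _; rewrite /= conj1g -(morph1g (@valM_subgroup _ N)) -D1N; exact: subgroup1.
have V1 := tube cJ cU oA A1.
set V := (fun t => _) in V1.
(* Openness of [D1] in [N]: writing [w = u * n], the factor [n] preserves [D0], so only conjugation
   by [U] matters, and [V] controls it uniformly. *)
have ND1 x : x \In N -> V x -> x \In D1.
  move=> Nx Vx; rewrite D1E => w; have [u [n [Uu Nn ->]]] := NU w.
  by rewrite conjgM; apply: D0J => //; apply: D0P; [exact: nN|exact: Vx].
(* The commutator of [k] and [v], trivial at [v = 1]; hence for [v] near [1] all of [K] is sent into
   the interior of [V]. *)
have cc : continuous (fun kv : set_type N * W => (val kv.1)^-1 * (val kv.1) ^ kv.2).
  have c1 : continuous (fun kv : set_type N * W => val kv.1).
    move=> x; apply: continuous_comp; first exact: continuous_fst.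
    exact: val_subgroup_cont.
  apply: continuousM; first exact: continuousV c1.
  exact: continuousJ c1 (@continuous_snd _ _).
have V1' : nbhs 1 V° by exact: nbhs_interior.
have K1 k : K k -> V° ((val (k, 1 : W).1)^-1 * val (k, 1 : W).1 ^ (k, 1 : W).2).
  by move=> _; rewrite /= conjg1 mulVg.
have V2 := tube cc cK (@open_interior _ V) K1.
set V' := (fun t => _) in V2.
(* For fixed [v], the [n] whose commutator with [v] lies in the normal subgroup [D1] form a
   subgroup, so checking the generators [K] suffices. *)
have comm v n : V' v -> n \In N -> n^-1 * n ^ v \In D1.
  move=> Vv Nn.
  have [|x y Sx Sy|S SE] := @ex_subgroup (set_type N)
    [set n | (val n)^-1 * val n ^ v \In D1].
  - rewrite /mkset (morph1g (@valM_subgroup _ N)) conj1g mulVg; exact: subgroup1.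
  - rewrite /mkset valM_subgroup (morphVg (@valM_subgroup _ N)).
    move: Sx Sy; rewrite /mkset; move: (val x) (val y) => a b Sa Sb.
    have -> : (a / b)^-1 * (a / b) ^ v = ((a^-1 * a ^ v) / (b^-1 * b ^ v)) ^ b^-1.
      by rewrite conjMg conjVg [RHS]conjgE_div !invgM !invgK !mulgA !mulgK.
    by apply: D1J; exact: subgroupF.
  have KS : generated_subgroup K `<=` S.
    apply: generated_min => k Kk; rewrite SE /=; apply: ND1.
      apply: subgroupM; first by apply: subgroupV; exact: set_valP.
      by apply: nN; exact: set_valP.
    by apply: interior_subset; exact: Vv.
  have : exist _ n (mem_set Nn) \In S by apply: KS; rewrite KT.
  by rewrite SE.
have [L [oL LV LJ]] := ex_normal_core tW cU (filterI V1 V2).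
have [E EE] := ex_subgroup_mul (Q := D1) (U := L) (fun q u Dq _ => D1J q u Dq).
exists E; split.
- by apply: open_subgroupS oL _; rewrite EE; exact: sub_mulr.
- move=> x w; rewrite EE => -[d Dd [l Ll <-]].
  have [u [n [Uu Nn wE]]] := NU w.
  have Ll' : l ^ u \In L by exact: LJ.
  have [_ V'l] := LV _ Ll'.
  have := comm _ _ V'l (subgroupV Nn); rewrite invgK => Dc.
  rewrite conjMg {2}wE conjgM; move: (l ^ u) Ll' Dc => m Lm Dc.
  (* Here [m ^ n] is [(m ^ n * m^-1) * m], and the bracket is a conjugate of the commutator of
     [n^-1] and [m], which [comm] puts in [D1]. *)
  exists (d ^ w * ((n * n^-1 ^ m) ^ n) ^ m^-1); last exists m => //.
    by apply: subgroupM; [exact: D1J|exact/D1J/D1J].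
  rewrite -mulgA -conjgCV; congr (_ * _).
  by rewrite !conjgE_div !mulgA mulgVK mulgV mul1g.
- move=> n; rewrite EE => -[d Dd [l Ll dl]].
  have Nl : l \In N.
    rewrite -(mulKg d l) dl; apply: subgroupM; last exact: set_valP.
    by apply: subgroupV; exact/D0N/D1D0.
  have Dl : l \In D1 by apply: ND1 => //; have [] := LV _ Ll.
  have : val n \In D0 by apply: D1D0; rewrite -dl; exact: subgroupM.
  by rewrite D0E => -[y Dy /val_inj <-].
Qed.

(* Exhaust R by compactly generated subgroups Q i normalised by U. Then the
   W i = (Q i) U exhaust G, and Res(W i) lies in Res(Q i). *)
Lemma rank_cocompact (xi : topologicalGroupType -> option ordinal_number)
    (G : topologicalGroupType) (R U : subgroup G) (rho : ordinal_number) :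
  decomposition_rank xi -> tdlcsc G -> closed R -> normal_subgroup R ->
  compact U -> open U -> [set: G] = [set r * u | r in R & u in U] ->
  residual G `<=` R -> ~ trivial_group (set_type R) ->
  xi (set_type R) = Some rho ->
  exists2 g, xi G = Some g & (g <= rho)%O.
Proof.
move=> rk tG cR nR cU oU GE ResR ntR xiR.
have evR := val_embedding cR.
have tR := embedding_tdlcsc evR tG.
have ntG : ~ trivial_group G.
  move=> trG; apply: ntR; apply/seteqP; split=> // x _; apply: val_inj.
  rewrite (morph1g (@valM_subgroup _ R)).
  have : [set: G] (val x) by [].
  by rewrite trG.
have [Q [K [KQ QR QU Qm Qu]]] := normal_exhaustion tG cR nR cU oU.
have /choice[W WE] i := ex_subgroup_mul (QU i).
have /choice[N NE] i := ex_preimage_subgroup (Q i) (@valM_subgroup _ R).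
have NP i x : x \In N i = (val x \In Q i) by rewrite NE.
have UW i : U `<=` W i by rewrite WE; exact: sub_mulr.
have QW i : Q i `<=` W i by rewrite WE; exact: sub_mull.
have oW i : open (W i) by apply: open_subgroupS oU (UW i).
have evW i := val_embedding (open_subgroup_closed (oW i)).
(* If [q * u] lies in [R], then [u] lies in both [R] and [U], hence in [Q i]. So [W i] meets [R]
   exactly in [Q i], which is therefore normal in [W i]. *)
have WRQ i x : x \In W i -> x \In R -> x \In Q i.
  rewrite WE => -[q Qq [u Uu <-]] Rqu; apply: subgroupM => //.
  apply: (QR i).1; split=> //; rewrite -(mulKg q u); apply: subgroupM => //.
  by apply: subgroupV; exact: (QR i).2.
have cgW i : compactly_generated (set_type (W i)).
  have [cK KE] := KQ i.
  apply: (compactly_generated_subgroup (K := K i `|` U)).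
  - exact: open_subgroup_closed.
  - exact: compactU.
  - apply/seteqP; split.
      apply: generated_min => x [Kx|]; last exact: UW.
      by apply: QW; rewrite -KE; exact: generated_subset.
    move=> x; rewrite {1}WE => -[q Qq [u Uu <-]]; apply: subgroupM.
      have : q \In generated_subgroup (K i) by rewrite KE.
      apply: generated_min => y Ky; apply: generated_subset; by left.
    by apply: generated_subset; right.
have oN i : open (N i).
  apply: open_subgroup; rewrite NE.
  apply: filterS (continuous_nbhs (@val_subgroup_cont _ R) (_ : nbhs (val 1) U)).
    by move=> x Ux; apply: (QR i).1; split=> //; exact: set_valP.
  by rewrite (morph1g (@valM_subgroup _ R)); exact: open_nbhs1.
have evN i := val_embedding (open_subgroup_closed (oN i)).
have cgN i : compactly_generated (set_type (N i)).
  have [cK KE] := KQ i.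
  apply: (compactly_generated_range (embedding_comp (evN i) evR) cK).
  rewrite KE; apply/seteqP; split=> [x Qx|_ [x _ <-]].
    have Rx : x \In R by exact: (QR i).2.
    pose y : set_type R := exist _ x (mem_set Rx).
    have Ny : y \In N i by rewrite NE.
    by exists (exist _ y (mem_set Ny) : set_type (N i)).
  by rewrite /= -NP; exact: set_valP.
have uW : increasing_union W.
  split=> [i j ij x|].
    rewrite !WE => -[q Qq [u Uu <-]]; exists q; first exact: Qm ij _ Qq.
    by exists u.
  apply/seteqP; split=> // x _; have : [set: G] x by [].
  rewrite GE => -[r Rr [u Uu <-]]; have [i _ Qr] : (\bigcup_i Q i) r by rewrite Qu.
  by exists i => //; apply: subgroupM; [exact: QW|exact: UW].
have uN : increasing_union N.
  split=> [i j ij x|]; first by rewrite !NE; exact: Qm.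
  apply/seteqP; split=> // x _.
  have [i _ Qx] : (\bigcup_i Q i) (val x) by rewrite Qu; exact: set_valP.
  by exists i => //; rewrite NE.
have eres i : embeds (set_type (residual (set_type (W i))))
                     (set_type (residual (set_type (N i)))).
  (* [M] is [Q i] seen inside [W i], whereas [N i] is [Q i] seen inside [R]. *)
  have [M ME] := ex_preimage_subgroup R (@valM_subgroup _ (W i)).
  have MP x : x \In M = (val x \In R) by rewrite ME.
  have tW := embedding_tdlcsc (evW i) tG.
  have MQ x : x \In M -> val x \In Q i.
    by rewrite ME => Rx; apply: WRQ => //; exact: set_valP.
  have cM : closed M by rewrite ME; exact: closed_preimage (@val_subgroup_cont _ _) cR.
  have evM := val_embedding cM.
  have nM : normal_subgroup M.
    by move=> x y; rewrite !MP (morphJg (@valM_subgroup _ (W i))); exact: nR.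
  have cgM : compactly_generated (set_type M).
    have [cK KE] := KQ i.
    apply: (compactly_generated_range (embedding_comp evM (evW i)) cK).
    rewrite KE; apply/seteqP; split=> [x Qx|_ [x _ <-]].
      pose y : set_type (W i) := exist _ x (mem_set (QW i x Qx)).
      have My : y \In M by rewrite ME; exact: (QR i).2.
      by exists (exist _ y (mem_set My) : set_type M).
    exact/MQ/set_valP.
  have oUW : open ((val : set_type (W i) -> G) @^-1` U).
    exact: open_preimage (@val_subgroup_cont _ _) oU.
  have [V VE] := ex_preimage_subgroup U (@valM_subgroup _ (W i)).
  have oV : open V by rewrite VE.
  have cV : compact V by rewrite VE; exact: embedding_compact (evW i) cU.
  have MV w : exists n u, [/\ n \In M, u \In V & w = n * u].
    have : val w \In W i by exact: set_valP.
    rewrite {1}WE => -[q Qq [u Uu quw]].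
    exists (exist _ q (mem_set (QW i q Qq))), (exist _ u (mem_set (UW i u Uu))).
    by split; [rewrite MP; exact: (QR i).2|rewrite VE|apply: val_inj; rewrite valM_subgroup].
  have MN : embeds (set_type M) (set_type (N i)).
    have eM := embedding_comp evM (evW i).
    have [x|g eg gE] := @embedding_factor _ _ R _ eM.
      by rewrite /= -MP; exact: set_valP.
    have [x|h eh _] := @embedding_factor _ _ (N i) _ eg; last by exists h.
    by rewrite NP gE; exact/MQ/set_valP.
  have eRW := val_embedding (@residual_closed (set_type (W i))).
  (* The residual of [W i] lies in that of [G], hence in [R], and [R] meets [W i] in [M]. *)
  have ResM (x : set_type (residual (set_type (W i)))) : val x \In M.
    by rewrite ME; apply/ResR/(embedding_residual (evW i)); exact: set_valP.
  have [f ef fE] := embedding_factor eRW ResM.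
  have fRes x : f x \In residual (set_type M).
    apply/residualP => D oD nD.
    have [E [oE nE ED]] := extend_open_normal tW nM cgM cV oV MV oD nD.
    apply: ED; rewrite fE.
    by have /residualP := set_valP x; apply.
  have [h eh _] := embedding_factor ef fRes.
  have [g eg] := embeds_residual MN.
  by exists (g \o h); exact: embedding_comp eh eg.
have /choice[r rE] : forall i, exists r,
    xi (set_type (residual (set_type (N i)))) = Some r.
  move=> i; have : xi (set_type R) <> None by rewrite xiR.
  move=> /(rank_defined rk tR ntR uN (fun j => conj (oN j) (cgN j)))/(_ i).
  by case: (xi _) => [r|//] _; exists r.
have [s [ubs _]] := rank_sup rk tR ntR uN (fun j => conj (oN j) (cgN j)) rE.
rewrite xiR => -[->].
have /choice[a aP] : forall i, exists a,
    xi (set_type (residual (set_type (W i)))) = Some a /\ (a <= s)%O.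
  move=> i; have [a xia ar] := rank_embeds rk (eres i) (rE i).
  by exists a; split=> //; apply: le_trans ar _; apply: ubs; exists i.
have aE i : xi (set_type (residual (set_type (W i)))) = Some (a i) by have [] := aP i.
have [t [_ lt] xiG] := rank_sup rk tG ntG uW (fun j => conj (oW j) (cgW j)) aE.
exists (osucc t) => //; rewrite leoSE; apply: lt => _ [i _ <-].
by have [] := aP i.
Qed.

(** * Open subgroups of prescribed rank *)

(** The image of [T] in [G] is another type, so embeddings both ways are recorded; [rank_iso] then
    carries the rank over. *)
Lemma open_subgroup_trans (G : topologicalGroupType) (S : subgroup G)
    (T : subgroup (set_type S)) :
  open S -> open T -> compactly_generated (set_type T) ->
  exists T' : subgroup G,
    [/\ open T', compactly_generated (set_type T'),
        embeds (set_type T) (set_type T') & embeds (set_type T') (set_type T)].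
Proof.
move=> oS oT cT.
have evS := val_embedding (open_subgroup_closed oS).
have evT := val_embedding (open_subgroup_closed oT).
have [T' TE] := ex_image_subgroup T (@valM_subgroup _ S).
have oT' : open T'.
  apply: open_subgroup; rewrite TE.
  have [V V1 VT] := val_subgroup_nbhs (open_nbhs1 oT).
  rewrite (morph1g (@valM_subgroup _ S)) in V1.
  apply: filterS2 V1 (open_nbhs1 oS) => x Vx Sx.
  by exists (exist _ x (mem_set Sx)) => //; exact: VT.
have [x|f ef fE] := @embedding_factor _ _ T' _ (embedding_comp evT evS).
  by rewrite TE; exists (val x) => //; exact: set_valP.
have evT' := val_embedding (open_subgroup_closed oT').
have TS x : x \In T' -> x \In S by rewrite TE => -[y _ <-]; exact: set_valP.
have [x|g eg gE] := @embedding_factor _ _ S _ evT'; first exact/TS/set_valP.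
have gT x : g x \In T.
  have := set_valP x; rewrite {1}TE => -[y Ty yx].
  by have -> : g x = y by apply: val_inj; rewrite gE.
have [h eh hE] := embedding_factor eg gT.
exists T'; split=> //; [|by exists f|by exists h].
apply: (compactly_generated_image (embM ef) (emb_cont ef)) cT => y.
by exists (h y) => //; apply: val_inj; rewrite fE /= hE gE.
Qed.

Lemma embeds_subgroup (G : topologicalGroupType) (H K : subgroup G) :
  closed H -> H `<=` K -> embeds (set_type H) (set_type K).
Proof.
move=> cH HK.
have [x|f ef _] := @embedding_factor _ _ K _ (val_embedding cH); last by exists f.
exact/HK/set_valP.
Qed.

Lemma rank_eq1 (xi : topologicalGroupType -> option ordinal_number)
    (G : topologicalGroupType) (g : ordinal_number) :
  decomposition_rank xi -> xi G = Some g ->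
  trivial_group G <-> g = osucc ozero.
Proof.
move=> rk xiG; have [tG _ _] := rank_range rk xiG.
by rewrite -(rank_trivial rk tG) xiG; split=> [[]//|->].
Qed.

(** If every residual in an exhaustion had rank at most [alpha], then [g] would be at most
    [alpha + 1]. *)
Lemma ex_compactly_generated_ge
    (xi : topologicalGroupType -> option ordinal_number)
    (G : topologicalGroupType) (g alpha : ordinal_number) :
  decomposition_rank xi -> xi G = Some g -> (osucc (osucc alpha) <= g)%O ->
  exists (O : subgroup G) r, [/\ open O, compactly_generated (set_type O),
    xi (set_type O) = Some (osucc r), xi (set_type (residual (set_type O))) = Some r
    & (osucc alpha <= r)%O /\ (osucc r <= g)%O].
Proof.
move=> rk xiG ag; have [tG _ _] := rank_range rk xiG.
have ntG : ~ trivial_group G.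
  move=> /(rank_eq1 rk xiG) gE; move: ag.
  by rewrite gE leoSE osucc_le ltNge ozero_le.
have [O [uO cgO]] := ex_exhaustion tG.
have evO i := val_embedding (open_subgroup_closed (cgO i).1).
have /choice[r rE] : forall i, exists r,
    xi (set_type (residual (set_type (O i)))) = Some r.
  move=> i; have : xi G <> None by rewrite xiG.
  by move=> /(rank_defined rk tG ntG uO cgO)/(_ i); case: (xi _) => [r|//] _; exists r.
have [s [_ lubs] xiGs] := rank_sup rk tG ntG uO cgO rE.
have [i ri] : exists i, (osucc alpha <= r i)%O.
  apply: contrapT => /forallNP nr.
  have sa : (s <= alpha)%O.
    apply: lubs => _ [i _ <-]; rewrite leNgt -osucc_le.
    exact/negP/nr.
  move: ag; have -> : g = osucc s by move: xiGs; rewrite xiG => -[].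
  by rewrite leoSE osucc_le ltNge sa.
(* For [alpha = 0] the chosen [O i] may be trivial, and then its rank is not the successor of that
   of its residual. Enlarging it to a nontrivial [O k] cannot lower the rank of the residual. *)
have [j ntj] : exists j, ~ trivial_group (set_type (O j)).
  apply: contrapT => /forallNP tO; apply: ntG; apply/seteqP; split=> // x _.
  have [j _ Ojx] : (\bigcup_j O j) x by rewrite uO.2.
  have trj : trivial_group (set_type (O j)) by apply: contrapT; exact: tO.
  have : [set: set_type (O j)] (exist _ x (mem_set Ojx)) by [].
  rewrite trj => /(congr1 val) /= ->.
  exact: (morph1g (@valM_subgroup _ (O j))).
pose k := maxn i j.
have jk x : x \In O j -> x \In O k by apply: uO.1; exact: leq_maxr.
have ntk : ~ trivial_group (set_type (O k)).
  move=> trk; apply: ntj; apply/seteqP; split=> // x _; apply: val_inj.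
  pose y : set_type (O k) := exist _ (val x) (mem_set (jk _ (set_valP x))).
  have : [set: set_type (O k)] y by [].
  rewrite trk => /(congr1 val).
  by rewrite (morph1g (@valM_subgroup _ (O k))) (morph1g (@valM_subgroup _ (O j))).
have ek : embeds (set_type (O k)) G by exists val; exact: evO.
have [o xio og] := rank_embeds rk ek xiG.
have [q xiq oE] := rank_compactly_generated rk ntk (cgO k).2 xio.
have Oik : O i `<=` O k by apply: uO.1; exact: leq_maxl.
have eik := embeds_subgroup (open_subgroup_closed (cgO i).1) Oik.
have [q' ] := rank_embeds rk (embeds_residual eik) xiq.
rewrite rE => -[<-] riq.
exists (O k), q; rewrite -oE; split=> //; [exact: (cgO k).1|exact: (cgO k).2|].
by split=> //; exact: le_trans ri riq.
Qed.

(* H = RU, where R = Res(W) and U is any compact open subgroup of W. *)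
Lemma ex_open_subgroup_rank_residual
    (xi : topologicalGroupType -> option ordinal_number)
    (W : topologicalGroupType) (r : ordinal_number) :
  decomposition_rank xi -> tdlcsc W -> ~ trivial_group (set_type (residual W)) ->
  xi (set_type (residual W)) = Some r ->
  exists2 H : subgroup W, open H & xi (set_type H) = Some r.
Proof.
move=> rk tW ntR xiR; set R := residual W in ntR xiR.
have cR : closed R := @residual_closed W.
have nR : normal_subgroup R := @residual_normal W.
have [U [cU oU _]] := ex_compact_open_subgroup tW (@filterT _ (nbhs (1 : W)) _).
have [H HE] := ex_subgroup_mul (Q := R) (U := U) (fun q u Rq _ => nR q u Rq).
have RH : R `<=` H by rewrite HE; exact: sub_mull.
have UH : U `<=` H by rewrite HE; exact: sub_mulr.
have oH : open H := open_subgroupS oU UH.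
have evH := val_embedding (open_subgroup_closed oH).
have tH := embedding_tdlcsc evH tW.
have [R' RE] := ex_preimage_subgroup R (@valM_subgroup _ H).
have [U' UE] := ex_preimage_subgroup U (@valM_subgroup _ H).
have RP x : x \In R' = (val x \In R) by rewrite RE.
have cR' : closed R' by rewrite RE; exact: closed_preimage (@val_subgroup_cont _ H) cR.
have RH' := embeds_subgroup cR RH.
have eR' : embeds (set_type R') (set_type R).
  have ev := embedding_comp (val_embedding cR') evH.
  have [x|f ef _] := @embedding_factor _ _ R _ ev; last by exists f.
  by have : val x \In R' := set_valP x; rewrite RP.
have eR : embeds (set_type R) (set_type R').
  have [x|f ef fE] := @embedding_factor _ _ H _ (val_embedding cR).
    exact/RH/set_valP.
  have [x|f' ef' _] := @embedding_factor _ _ R' _ ef; last by exists f'.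
  by rewrite RP fE; exact: set_valP.
have xiR' := rank_iso rk eR' eR xiR.
have [h xiH hr] : exists2 h, xi (set_type H) = Some h & (h <= r)%O.
  apply: (rank_cocompact (R := R') (U := U')) => //.
  - by move=> x y; rewrite !RP (morphJg (@valM_subgroup _ H)); exact: nR.
  - by rewrite UE; exact: embedding_compact evH cU.
  - by rewrite UE; exact: open_preimage (@val_subgroup_cont _ H) oU.
  - apply/seteqP; split=> // x _; have : val x \In H by exact: set_valP.
    rewrite {1}HE => -[q Rq [u Uu qux]].
    exists (exist _ q (mem_set (RH _ Rq))); first by rewrite RE.
    exists (exist _ u (mem_set (UH _ Uu))); first by rewrite UE.
    by apply: val_inj; rewrite valM_subgroup.
  - by move=> x Rx; rewrite RE; exact: (embedding_residual evH).
  - by rewrite (rank_eq1 rk xiR') -(rank_eq1 rk xiR).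
(* The reverse inequality: [R] is a closed subgroup of [H]. *)
have [r' ] := rank_embeds rk RH' xiH; rewrite xiR => -[<-] rh.
by exists H => //; rewrite xiH; congr Some; apply: le_anti; rewrite hr.
Qed.

Theorem theorem4p20 (xi : topologicalGroupType -> option ordinal_number)
    (xi_rank : decomposition_rank xi) (G : topologicalGroupType)
    (G_tdlcsc : tdlcsc G) (G_elementary : elementary G) (alpha : ordinal_number)
    (alpha_le : exists2 g : ordinal_number,
       xi G = Some g & (osucc (osucc alpha) <= g)%O) :
  exists O : subgroup G,
    [/\ open O, compactly_generated (set_type O)
      & xi (set_type O) = Some (osucc (osucc alpha))].
Proof.
case: alpha_le => g xiG ag; move: G xiG ag {G_tdlcsc G_elementary}.
(* [G] is generalised because the induction hypothesis is applied to [H], an open subgroup of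
   [O]. *)
elim/Defs.ordinal_ind: g => g IH G xiG ag.
have [O [r [oO cO xiO xiR [ar rg]]]] := ex_compactly_generated_ge xi_rank xiG ag.
have [rE|nr] := eqVneq r (osucc alpha); first by exists O; rewrite xiO rE.
have {nr}ar : (osucc (osucc alpha) <= r)%O by rewrite osucc_le lt_neqAle eq_sym nr.
have ntR : ~ trivial_group (set_type (residual (set_type O))).
  rewrite (rank_eq1 xi_rank xiR) => rE; move: ar.
  by rewrite rE leoSE osucc_le ltNge ozero_le.
have [tO _ _] := rank_range xi_rank xiO.
have [H oH xiH] := ex_open_subgroup_rank_residual xi_rank tO ntR xiR.
have [|T [oT cT xiT]] := IH r _ _ xiH ar; first by rewrite -osucc_le.
(* The subgroup found in [H] is carried first to [O] and then to [G]. *)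
have [T' [oT' cT' TT' T'T]] := open_subgroup_trans oH oT cT.
have [S [oS cS T'S ST']] := open_subgroup_trans oO oT' cT'.
exists S; split=> //; apply: (rank_iso xi_rank ST' T'S).
exact: rank_iso xi_rank T'T TT' xiT.
Qed.
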